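(* There exist two subgraphs $X,Y$ of the $2$-dimensional integer grid (the Cayley graph of $\mathbb{Z}^2$ with respect to the standard generators) such that for every integer $k\geq 2$ there is an infinite subset $I_k\subset\mathbb{N}$ such that for all $n\in I_k$: (a) $\mathrm{wir}^{k-1}_{X\to Y}(n)\geq \left(\frac{n}{k(k+1)}\right)^2$, and (b) $\mathrm{wir}^{k}_{X\to Y}(n)\leq 2n$.
   Context: All graphs are simple, undirected. A wiring of a finite graph $\Gamma$ into a graph $Y$ is a continuous map $f:\Gamma\to Y$ (graphs viewed as 1-dimensional cell complexes) sending vertices to vertices and each edge of $\Gamma$ onto a union of edges of $Y$ (i.e. onto a path in $Y$ between the images of its endpoints, or onto a single vertex when both endpoints have the same image). A wiring $f$ is a coarse $k$-wiring if (1) $|\{v\in V\Gamma: f(v)=w\}|\leq k$ for every $w\in VY$, and (2) every edge of $Y$ is contained in the images $f(e)$ of at most $k$ edges $e\in E\Gamma$. The image $\mathrm{im}(f)$ is the subgraph of $Y$ consisting of all vertices and edges in the image of $f$; the volume $\mathrm{vol}(f)$ is the number of vertices of $\mathrm{im}(f)$. $\mathrm{wir}^k(\Gamma\to Y)$ is the minimal volume of a coarse $k$-wiring of $\Gamma$ into $Y$ ($+\infty$ if none exists). For graphs $X,Y$, the $k$-wiring profile is $\mathrm{wir}^k_{X\to Y}(n)=\max\{\mathrm{wir}^k(\Gamma\to Y): \Gamma \text{ a subgraph of } X,\ |V\Gamma|\leq n\}$. *)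

(* Defs.v *)
From mathcomp Require Import all_boot all_order all_algebra.
Set Implicit Arguments. Unset Strict Implicit. Unset Printing Implicit Defensive.
Import Order.TTheory GRing.Theory Num.Theory.

Definition Vtx := (int * int)%type.

Definition grid_adj (x y : Vtx) : bool :=
  (absz (x.1 - y.1)%R + absz (x.2 - y.2)%R == 1)%N.

Record gsub := GSub { gV : Vtx -> Prop; gE : Vtx -> Vtx -> Prop }.

Definition is_grid_subgraph (G : gsub) : Prop :=
  (forall x y, gE G x y -> gE G y x) /\
  (forall x y, gE G x y -> [/\ gV G x, gV G y & grid_adj x y]).

(* A finite graph: list of vertices, list of edges (each undirected edge
   listed once, as an ordered pair in one of its two orientations). *)
Record fgraph := FGraph { fV : seq Vtx; fE : seq (Vtx * Vtx) }.

Definition finite_subgraph_of (Gam : fgraph) (X : gsub) : Prop :=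
  [/\ uniq (fV Gam), (forall v, v \in fV Gam -> gV X v), uniq (fE Gam) &
      forall e, e \in fE Gam ->
        [/\ e.1 \in fV Gam, e.2 \in fV Gam, gE X e.1 e.2 & (e.2, e.1) \notin fE Gam]].

(* p is a (simple) path in Y from a to b (a single vertex if a = b). *)
Definition is_path_in (Y : gsub) (p : seq Vtx) (a b : Vtx) : Prop :=
  exists q, [/\ p = a :: q, last a q = b, uniq p,
                (forall x, x \in p -> gV Y x) &
                (forall x y, (x, y) \in zip p (behead p) -> gE Y x y)].

Record wiring := Wiring { wv : Vtx -> Vtx; wp : Vtx * Vtx -> seq Vtx }.

Definition is_wiring (Gam : fgraph) (Y : gsub) (f : wiring) : Prop :=
  (forall v, v \in fV Gam -> gV Y (wv f v)) /\
  (forall e, e \in fE Gam -> is_path_in Y (wp f e) (wv f e.1) (wv f e.2)).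

Definition uses_edge (p : seq Vtx) (a b : Vtx) : bool :=
  ((a, b) \in zip p (behead p)) || ((b, a) \in zip p (behead p)).

Definition coarse (k : nat) (Gam : fgraph) (Y : gsub) (f : wiring) : Prop :=
  (forall w, (count (fun v => wv f v == w) (fV Gam) <= k)%N) /\
  (forall a b, gE Y a b -> (count (fun e => uses_edge (wp f e) a b) (fE Gam) <= k)%N).

Definition vol (Gam : fgraph) (f : wiring) : nat :=
  size (undup (map (wv f) (fV Gam) ++ flatten (map (wp f) (fE Gam)))).

(* wir^k(Gam -> Y) >= b  (the minimum is +oo if no coarse k-wiring exists). *)
Definition wir_ge (k : nat) (Gam : fgraph) (Y : gsub) (b : rat) : Prop :=
  forall f, is_wiring Gam Y f -> coarse k Gam Y f -> (b <= (vol Gam f)%:R)%R.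

Definition wir_le (k : nat) (Gam : fgraph) (Y : gsub) (m : nat) : Prop :=
  exists f, [/\ is_wiring Gam Y f, coarse k Gam Y f & (vol Gam f <= m)%N].

(* wir^k_{X->Y}(n) >= b  (max over finite subgraphs of X with <= n vertices). *)
Definition wirprof_ge (k : nat) (X Y : gsub) (n : nat) (b : rat) : Prop :=
  exists Gam, [/\ finite_subgraph_of Gam X, (size (fV Gam) <= n)%N & wir_ge k Gam Y b].

Definition wirprof_le (k : nat) (X Y : gsub) (n m : nat) : Prop :=
  forall Gam, finite_subgraph_of Gam X -> (size (fV Gam) <= n)%N -> wir_le k Gam Y m.

Definition infinite_nat (I : nat -> Prop) : Prop :=
  forall m, exists n, (m <= n)%N /\ I n.

(* Main.v *)
Require Import Defs.
From mathcomp Require Import all_boot all_order all_algebra.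
From mathcomp Require Import zify.
Set Implicit Arguments. Unset Strict Implicit. Unset Printing Implicit Defensive.
Import Order.TTheory GRing.Theory Num.Theory.

(** Stage [j] of [X] and [Y] is a ladder with [rows j] horizontal lines and [4 * rows j]
    full vertical columns; consecutive columns are [gapX j] apart in [X] and [gapY j] apart
    in [Y], where [gapY j] exceeds the square of the size of stage [j] of [X] and
    [gapX j.+1] exceeds the size of stage [j] of [Y]; every value of [rows] is taken
    infinitely often.

    Lower bound: in a (k-1)-wiring of stage [i] of [X], [k = rows i], the image lies in one
    stage of [Y], by counting not in an earlier one, and if its volume is below the column
    gap it meets at most one column, so that every edge of it is a cut edge.  An edge of
    the image separates at most k-1 of the 4k columns from the others, and two sweeps,
    vertical then horizontal, leave at least 4k - 4(k-1) columns mapped to a single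
    vertex, which receives at most k-1 of the k points of such a column.

    Upper bound: a subgraph with at most [area gapX i] vertices is stretched, without
    lengthening any edge in the later stages, since it misses some abscissa between any two
    consecutive columns there; stage [i], which may be taken whole, is projected onto one
    line with load k; the earlier stages of [Y] have small total size. *)

(** * Counting through injections and through fibres *)

Lemma count_le_size_inj (T U : eqType) (P : pred T) (h : T -> U)
    (s : seq T) (t : seq U) :
  uniq s -> {in [seq x <- s | P x] &, injective h} ->
  (forall x, x \in s -> P x -> h x \in t) -> count P s <= size t.
Proof.
move=> us injh ht; rewrite -size_filter -(size_map h).
apply: uniq_leq_size; first by rewrite map_inj_in_uniq ?filter_uniq.
by move=> _ /mapP[x + ->]; rewrite mem_filter => /andP[Px xs]; apply: ht.
Qed.

Lemma size_le_fibers (T U : eqType) (h : T -> U) (m : nat) (s : seq T) (t : seq U) :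
  (forall x, x \in s -> h x \in t) ->
  (forall y, count (fun x => h x == y) s <= m) -> size s <= m * size t.
Proof.
move=> + hm; elim: t s hm => [|y t IH] s hm hs.
  by case: s hs {hm} => // x s /(_ x (mem_head _ _)).
rewrite -(count_predC (fun x => h x == y)) /= mulnS leq_add //.
rewrite -size_filter; apply: IH => [z|x].
  by rewrite count_filter (leq_trans _ (hm z)) //; apply: sub_count => x /andP[].
rewrite mem_filter => /andP[/= hxy /hs]; rewrite inE => /orP[/eqP e|//].
by rewrite e eqxx in hxy.
Qed.

(** * Consecutive pairs of a path, reversal, and functions constant along a path *)

Section Paths.
Variable T : eqType.
Implicit Types (p : seq T) (x y : T).

Lemma mem_consecutive p x y :
  reflect (exists p1 p2, p = p1 ++ x :: y :: p2) ((x, y) \in zip p (behead p)).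
Proof.
apply: (iffP idP) => [|[p1 [p2 ->]]].
  elim: p => [//|a [//|b p] IH] /=; rewrite inE => /orP[/eqP[-> ->]|/IH[p1 [p2 e]]].
    by exists [::], p.
  by exists (a :: p1), p2; rewrite /= -e.
elim: p1 => [|a [|b p1] IH] /=; first by rewrite mem_head.
  by rewrite !inE eqxx orbT.
by rewrite inE; apply/orP; right.
Qed.

Arguments mem_consecutive {p x y}.

Lemma mem_consecutive_rev p x y :
  ((x, y) \in zip (rev p) (behead (rev p))) = ((y, x) \in zip p (behead p)).
Proof.
have sub (q : seq T) a b : (a, b) \in zip q (behead q) -> (b, a) \in zip (rev q) (behead (rev q)).
  move=> /mem_consecutive[p1 [p2 ->]]; apply/mem_consecutive.
  by exists (rev p2), (rev p1); rewrite rev_cat !rev_cons !cat_rcons.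
by apply/idP/idP => /sub //; rewrite revK.
Qed.

Lemma mem_of_consecutive p x y :
  (x, y) \in zip p (behead p) -> x \in p /\ y \in p.
Proof.
by move=> /mem_consecutive[p1 [p2 ->]]; rewrite !mem_cat !inE !eqxx !orbT.
Qed.

End Paths.

Arguments mem_consecutive {T p x y}.

Lemma uses_edge_rev p a b : uses_edge (rev p) a b = uses_edge p a b.
Proof. by rewrite /uses_edge !mem_consecutive_rev orbC. Qed.

Lemma is_path_in_rev (Y : gsub) p a b :
  (forall x y, gE Y x y -> gE Y y x) ->
  is_path_in Y p a b -> is_path_in Y (rev p) b a.
Proof.
move=> symY [q [-> lq up pV pE]].
exists (behead (rev (a :: q))); split.
- case: (lastP q) lq => [/= -> //|q' c]; rewrite last_rcons => ->.
  by rewrite -rcons_cons rev_rcons.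
- case: (lastP q) lq => [//|q' c]; rewrite last_rcons => _.
  by rewrite -rcons_cons rev_rcons /= rev_cons last_rcons.
- by rewrite rev_uniq.
- by move=> x; rewrite mem_rev; apply: pV.
- by move=> x y; rewrite mem_consecutive_rev => /pE /symY.
Qed.

Lemma path_invariant (Y : gsub) (T : Type) (g : Vtx -> T) p a b :
  is_path_in Y p a b ->
  (forall x y, (x, y) \in zip p (behead p) -> g x = g y) ->
  forall x, x \in p -> g x = g a.
Proof.
case=> q [-> _ _ _ _]; elim: q a => [|c q IH] a gE x.
  by rewrite inE => /eqP ->.
rewrite inE => /orP[/eqP -> //|xq].
rewrite (gE a c) ?mem_head //; apply: IH xq => u v uv.
by apply: gE; rewrite /= inE uv orbT.
Qed.

Lemma path_ends (Y : gsub) p a b : is_path_in Y p a b -> a \in p /\ b \in p.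
Proof. by case=> q [-> <- _ _ _]; rewrite mem_head mem_last. Qed.

(** * The two graphs *)

(** The 2-adic valuation serves as an explicit function taking every value infinitely often. It
    vanishes at 0 and at odd numbers, so those stages are empty. *)
Definition rows (j : nat) : nat := logn 2 j.
Definition cols (j : nat) : nat := 4 * rows j.

(* Stage [j] lives in the horizontal band 2^j <= y < 2^j + rows j; as rows j <= 2^j the
   stage is recovered from y by the binary logarithm. *)
Definition emb (j r x : nat) : Vtx := (Posz x, Posz (2 ^ j + r)).
Definition stage (v : Vtx) : nat := trunc_log 2 (absz v.2).
Definition level (v : Vtx) : nat := absz v.2 - 2 ^ stage v.
Definition abscissa (v : Vtx) : nat := absz v.1.

Lemma rows_lt j r : r < rows j -> r < 2 ^ j.
Proof.
rewrite /rows; case: (posnP j) => [-> //|j0] rj.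
by rewrite (ltn_trans rj) // (ltn_trans (ltn_logl 2 j0)) // ltn_expl.
Qed.

Lemma stage_emb j r x : r < rows j -> stage (emb j r x) = j.
Proof.
move=> /rows_lt rj; apply: trunc_log_eq => //.
by rewrite /= leq_addr expnS mul2n -addnn ltn_add2l.
Qed.

Lemma level_emb j r x : r < rows j -> level (emb j r x) = r.
Proof. by move=> rj; rewrite /level stage_emb //= addKn. Qed.

Lemma abscissa_emb j r x : abscissa (emb j r x) = x.
Proof. by []. Qed.

Definition embE := (stage_emb, level_emb, abscissa_emb).

Lemma emb_inj j r x j' r' x' : r < rows j -> r' < rows j' ->
  emb j r x = emb j' r' x' -> [/\ j = j', r = r' & x = x'].
Proof.
move=> rj rj' e; split.
- by rewrite -(stage_emb x rj) e stage_emb.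
- by rewrite -(level_emb x rj) e level_emb.
- by rewrite -(abscissa_emb j r x) e.
Qed.

Section Ladder.
Variable S : nat -> nat.

(** Steps point right or up; [ladder] symmetrizes them, so each undirected edge has exactly one
    representative here. *)
Inductive ladder_step : Vtx -> Vtx -> Prop :=
| Hstep j r x of r < rows j & x.+1 < cols j * S j :
    ladder_step (emb j r x) (emb j r x.+1)
| Vstep j r c of r.+1 < rows j & c < cols j :
    ladder_step (emb j r (c * S j)) (emb j r.+1 (c * S j)).

Definition ladder_vertex (v : Vtx) : Prop :=
  exists j r x, [/\ r < rows j, x < cols j * S j & v = emb j r x].

Definition ladder : gsub :=
  GSub ladder_vertex (fun a b => ladder_step a b \/ ladder_step b a).

Definition area (j : nat) : nat := rows j * (cols j * S j).

Definition stage_vertices (j : nat) : seq Vtx :=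
  [seq emb j r x | r <- iota 0 (rows j), x <- iota 0 (cols j * S j)].

Lemma size_stage_vertices j : size (stage_vertices j) = area j.
Proof. by rewrite size_allpairs !size_iota. Qed.

Lemma mem_stage_vertices j r x : r < rows j -> x < cols j * S j ->
  emb j r x \in stage_vertices j.
Proof. by move=> rj xj; apply/allpairsP; exists (r, x); rewrite /= !mem_iota. Qed.

Lemma stage_verticesP j v : v \in stage_vertices j ->
  exists r x, [/\ r < rows j, x < cols j * S j & v = emb j r x].
Proof.
by move=> /allpairsP[[r x] /=]; rewrite !mem_iota /= !add0n => -[? ? ->]; exists r, x.
Qed.

Lemma stage_vertices_uniq j : uniq (stage_vertices j).
Proof.
apply: allpairs_uniq; rewrite ?iota_uniq // => -[r x] [r' x'].
move=> /allpairsP[[? ?] /= [+ _ [-> _]]] /allpairsP[[? ?] /= [+ _ [-> _]]].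
rewrite !mem_iota !add0n /= => rj rj' /= e.
by have [_ -> ->] := emb_inj rj rj' e.
Qed.

Lemma ladder_vertexP v : ladder_vertex v -> v \in stage_vertices (stage v).
Proof. by move=> [j [r [x [rj xj ->]]]]; rewrite stage_emb ?mem_stage_vertices. Qed.

Lemma ladder_vertex_emb v : ladder_vertex v ->
  v = emb (stage v) (level v) (abscissa v).
Proof. by move=> [j [r [x [rj xj ->]]]]; rewrite !embE. Qed.

Lemma ladder_vertex_level v : ladder_vertex v -> level v < rows (stage v).
Proof. by move=> [j [r [x [rj xj ->]]]]; rewrite !embE. Qed.

Lemma ladder_sym x y : gE ladder x y -> gE ladder y x.
Proof. by case; [right|left]. Qed.

Lemma ladder_step_stage a b : ladder_step a b -> stage a = stage b.
Proof. by case=> [j r x rj _|j r c rj _]; rewrite !stage_emb // ltnW. Qed.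

Lemma ladder_edge_stage a b : gE ladder a b -> stage a = stage b.
Proof. by case=> /ladder_step_stage. Qed.

Hypothesis S_gt0 : forall j, 0 < S j.

Lemma ladder_step_vertices a b :
  ladder_step a b -> ladder_vertex a /\ ladder_vertex b.
Proof.
case=> [j r x rj xj|j r c rj cj]; split.
- by exists j, r, x; rewrite rj (ltnW xj).
- by exists j, r, x.+1; rewrite rj xj.
- by exists j, r, (c * S j); rewrite ltnW // ltn_pmul2r.
- by exists j, r.+1, (c * S j); rewrite rj ltn_pmul2r.
Qed.

Lemma ladder_step_adj a b : ladder_step a b -> grid_adj a b /\ grid_adj b a.
Proof. by case=> [j r x _ _|j r c _ _]; rewrite /grid_adj /=; split; lia. Qed.

Lemma ladder_is_grid_subgraph : is_grid_subgraph ladder.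
Proof.
split=> [|x y]; first exact: ladder_sym.
by case=> st; have [? ?] := ladder_step_vertices st;
  have [? ?] := ladder_step_adj st; split.
Qed.

End Ladder.

(** * The two sequences of column gaps and their growth *)

(** The successor value is [(gapX i + area gapY i).+1] with [gapY] written out, since [gapY] is
    itself defined from [gapX]. *)
Fixpoint gapX (j : nat) : nat :=
  if j is i.+1 then
    (gapX i + rows i * (cols i * (gapX i + (rows i * (cols i * gapX i)) ^ 2))).+1
  else 1.

(** The square serves the lower bound; the summand [gapX j] gives [gapX j <= gapY j], so that a
    stage of [X] can be stretched onto the same stage of [Y]. *)
Definition gapY (j : nat) : nat := gapX j + area gapX j ^ 2.

Lemma gapXS j : gapX j.+1 = (gapX j + area gapY j).+1.
Proof. by []. Qed.

Lemma gapX_gt0 j : 0 < gapX j.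
Proof. by case: j. Qed.

Lemma gapX_le_gapY j : gapX j <= gapY j.
Proof. exact: leq_addr. Qed.

Lemma gapY_gt0 j : 0 < gapY j.
Proof. exact: leq_trans (gapX_gt0 j) (gapX_le_gapY j). Qed.

Lemma gapX_mono j i : j <= i -> gapX j <= gapX i.
Proof.
elim: i => [|i IH]; first by rewrite leqn0 => /eqP ->.
rewrite leq_eqVlt => /orP[/eqP -> //|/IH ji].
by rewrite gapXS leqW // (leq_trans ji) // leq_addr.
Qed.

Lemma area_gapY_lt j i : j < i -> area gapY j < gapX i.
Proof. by move=> /gapX_mono; apply: leq_trans; rewrite gapXS ltnS leq_addl. Qed.

Lemma area_gapX_lt j i : j < i -> area gapX j < gapX i.
Proof.
move=> /area_gapY_lt; apply: leq_ltn_trans.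
by rewrite /area !leq_mul2l gapX_le_gapY !orbT.
Qed.

Lemma ltn_gapX j : j < gapX j.
Proof. by elim: j => // j IH; rewrite gapXS; lia. Qed.

Lemma gap_le_area S i : 0 < rows i -> S i <= area S i.
Proof. by move=> ri; rewrite /area /cols mulnA leq_pmull // !muln_gt0 ri. Qed.

(** Each step of the recursion for [gapX] adds the area of one stage of [Y], so the sum
    telescopes. *)
Lemma sum_area_gapY i : \sum_(j <- iota 0 i) area gapY j <= gapX i.
Proof.
elim: i => [|i IH]; first by rewrite big_nil.
by rewrite -{1}addn1 iotaD big_cat big_seq1 gapXS leqW // leq_add2r.
Qed.

Lemma area_gapX_sq_le i j : 0 < rows i -> i <= j -> area gapX i ^ 2 <= gapY j.
Proof.
move=> ri; rewrite leq_eqVlt => /orP[/eqP <-|ij]; first exact: leq_addl.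
rewrite (leq_trans (leq_addl (gapX i) _)) // (leq_trans (gap_le_area gapY ri)) //.
by rewrite (leq_trans (ltnW (area_gapY_lt ij))) // gapX_le_gapY.
Qed.

(** * Lower bound *)

(** The coordinate sum recovers the orientation of a step: it shows that no edge is listed in both
    directions, and later decides which end comes first. *)
Lemma ladder_step_lt S a b : ladder_step S a b ->
  absz a.1 + absz a.2 < absz b.1 + absz b.2.
Proof. by case=> *; rewrite /emb /=; lia. Qed.

(** * A full stage as a finite graph, and its connectedness *)

Section StageGraph.
Variables (S : nat -> nat) (i : nat).
Hypothesis S_gt0 : forall j, 0 < S j.

Definition stage_edges : seq (Vtx * Vtx) :=
  [seq (emb i r x, emb i r x.+1) | r <- iota 0 (rows i), x <- iota 0 (cols i * S i).-1]
  ++ [seq (emb i r (c * S i), emb i r.+1 (c * S i))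
        | c <- iota 0 (cols i), r <- iota 0 (rows i).-1].

Definition stage_graph : Defs.fgraph := FGraph (stage_vertices S i) stage_edges.

Lemma mem_Hedge r x : r < rows i -> x.+1 < cols i * S i ->
  (emb i r x, emb i r x.+1) \in stage_edges.
Proof.
move=> rj xj; rewrite mem_cat; apply/orP; left; apply/allpairsP; exists (r, x).
by rewrite /= !mem_iota !add0n; split => //=; lia.
Qed.

Lemma mem_Vedge r c : r.+1 < rows i -> c < cols i ->
  (emb i r (c * S i), emb i r.+1 (c * S i)) \in stage_edges.
Proof.
move=> rj cj; rewrite mem_cat; apply/orP; right; apply/allpairsP; exists (c, r).
by rewrite /= !mem_iota !add0n; split => //=; lia.
Qed.

Lemma stage_edges_step e : e \in stage_edges -> ladder_step S e.1 e.2 /\ stage e.1 = i.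
Proof.
rewrite mem_cat => /orP[] /allpairsP[[a b] /=]; rewrite !mem_iota !add0n /=.
  move=> [ra xb ->] /=; rewrite stage_emb //; split=> //.
  by apply: Hstep => //; lia.
move=> [ca rb ->] /=; have rb' : b.+1 < rows i by lia.
by rewrite stage_emb ?(ltnW rb') //; split=> //; apply: Vstep.
Qed.

Lemma stage_graph_sub : finite_subgraph_of stage_graph (ladder S).
Proof.
have vst v : ladder_vertex S v -> stage v = i -> v \in stage_vertices S i.
  by move=> /ladder_vertexP + <-.
split=> /=.
- exact: stage_vertices_uniq.
- by move=> v /stage_verticesP[r [x [rj xj ->]]]; exists i, r, x.
- rewrite /stage_edges cat_uniq; apply/and3P; split.
  + apply: allpairs_uniq; rewrite ?iota_uniq // => -[r x] [r' x'] _ _ /=.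
    by rewrite /emb => -[] *; congr (_, _); lia.
  + apply/hasPn => _ /allpairsP[[c r] /= [_ _ ->]].
    by apply/allpairsP => -[[r' x] /= [_ _]]; rewrite /emb => -[]; lia.
  + apply: allpairs_uniq; rewrite ?iota_uniq // => -[c r] [c' r'] _ _ /=.
    rewrite /emb => -[/eqP + e _ _]; rewrite eqn_pmul2r // => /eqP ->.
    by congr (_, _); lia.
- move=> e /[dup] es /stage_edges_step[st s1].
  have [v1 v2] := ladder_step_vertices S_gt0 st.
  split; [exact: vst | | by left |].
    by apply: vst => //; rewrite -(ladder_step_stage st).
  apply/negP => /stage_edges_step[/ladder_step_lt + _].
  by have /= := ladder_step_lt st; lia.
Qed.

Lemma row_connected (T : Type) (g : Vtx -> T) r :
  (forall x, x.+1 < cols i * S i -> g (emb i r x) = g (emb i r x.+1)) ->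
  forall x, x < cols i * S i -> g (emb i r x) = g (emb i r 0).
Proof.
by move=> gE; elim=> // x IH xj; rewrite -gE // IH // ltnW.
Qed.

Lemma column_connected (T : Type) (g : Vtx -> T) c :
  (forall r, r.+1 < rows i -> g (emb i r (c * S i)) = g (emb i r.+1 (c * S i))) ->
  forall r, r < rows i -> g (emb i r (c * S i)) = g (emb i 0 (c * S i)).
Proof.
by move=> gE; elim=> // r IH rj; rewrite -gE // IH // ltnW.
Qed.

(** Every vertex reaches the corner along its row to abscissa 0, then down the leftmost column. *)
Lemma stage_connected (T : Type) (g : Vtx -> T) :
  (forall e, e \in stage_edges -> g e.1 = g e.2) ->
  forall v, v \in stage_vertices S i -> g v = g (emb i 0 0).
Proof.
move=> gE _ /stage_verticesP[r [x [rj xj ->]]].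
rewrite row_connected // => [|y yj]; last by have /= := gE _ (mem_Hedge rj yj).
have c0 : 0 < cols i by case: (cols i) xj.
rewrite -(mul0n (S i)) column_connected // => q qj.
by have /= := gE _ (mem_Vedge qj c0).
Qed.

End StageGraph.

(** * Cuts and sweeps for a wiring of a full stage *)

Section LowerBound.
Variables (i : nat) (f : wiring).
Hypothesis rows_gt1 : 1 < rows i.
Let K := rows i.
Let D := gapX i.
Let G := stage_graph gapX i.
Let Y := ladder gapY.
Hypothesis wf : is_wiring G Y f.
Hypothesis cf : coarse K.-1 G Y f.

Let im : seq Vtx := map (wv f) (fV G) ++ flatten (map (wp f) (fE G)).

(** Pairs are ordered by the direction of travel along a path, hence the two alternatives in the cut
    hypotheses below. *)
Definition used (a b : Vtx) : Prop :=
  exists2 e, e \in fE G & (a, b) \in zip (wp f e) (behead (wp f e)).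

Lemma used_edge a b : used a b -> gE Y a b.
Proof. by case=> e /wf.2[q [_ _ _ _]]; apply. Qed.

Lemma used_in_im a b : used a b -> a \in im /\ b \in im.
Proof.
case=> e eG /mem_of_consecutive[ap bp]; rewrite /im !mem_cat.
by split; apply/orP; right; apply/flattenP; exists (wp f e); rewrite ?map_f.
Qed.

Lemma wv_in_im v : v \in fV G -> wv f v \in im.
Proof. by move=> vG; rewrite mem_cat map_f. Qed.

(** Coarseness bounds the load of edges of [Y] only; a pair that is not an edge occurs on no path.
    Cut edges can thus be proposed below without checking that they are edges. *)
Lemma edge_load a b : count (fun e => uses_edge (wp f e) a b) (fE G) <= K.-1.
Proof.
case: (posnP (count (fun e => uses_edge (wp f e) a b) (fE G))) => [->//|].
rewrite -has_count => /hasP[e eG /orP[ab|ba]]; apply: cf.2.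
  by apply: used_edge; exists e.
by apply/ladder_sym/used_edge; exists e.
Qed.

Lemma edge_in_G e : e \in fE G -> e.1 \in fV G /\ e.2 \in fV G.
Proof. by have [_ _ _ h] := stage_graph_sub i gapX_gt0 => /h[]. Qed.

(** Connectedness of the image, in the form that a function preserved by used pairs is constant. *)
Lemma im_const (T : Type) (g : Vtx -> T) :
  (forall a b, used a b -> g a = g b) ->
  forall a, a \in im -> g a = g (wv f (emb i 0 0)).
Proof.
move=> gE; have gp e : e \in fE G -> forall x, x \in wp f e -> g x = g (wv f e.1).
  by move=> eG x; apply: (path_invariant (wf.2 _ eG)) => u v uv; apply: gE; exists e.
have gV : forall v, v \in fV G -> g (wv f v) = g (wv f (emb i 0 0)).
  apply: (@stage_connected gapX i _ (g \o wv f)) => e eG /=.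
  by rewrite (gp e eG (wv f e.2)) // (path_ends (wf.2 _ eG)).2.
move=> a; rewrite mem_cat => /orP[/mapP[v vG ->]|/flattenP[_ /mapP[e eG ->] ae]].
  exact: gV.
by rewrite (gp e) // gV // (edge_in_G eG).1.
Qed.

Lemma cut_edge (T : eqType) (g : Vtx -> T) a0 b0 :
  (forall a b, used a b -> g a != g b -> (a, b) = (a0, b0) \/ (a, b) = (b0, a0)) ->
  forall e, e \in fE G -> g (wv f e.1) != g (wv f e.2) -> uses_edge (wp f e) a0 b0.
Proof.
move=> cutg e eG; apply: contraNT => /norP[nab nba]; apply/eqP/esym.
apply: (path_invariant (wf.2 _ eG)); last exact: (path_ends (wf.2 _ eG)).2.
move=> x y xy; apply/eqP; apply: contraT => gxy.
have [|e1|e1] := cutg x y _ gxy; first by exists e.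
  by rewrite -e1 xy in nab.
by rewrite -e1 xy in nba.
Qed.

Definition on_column (P : pred Vtx) (c : nat) : bool :=
  all (fun r => P (wv f (emb i r (c * D)))) (iota 0 K).

(* An edge of the image is crossed by at most K - 1 edges of G, so at most K - 1 columns
   are cut by it; two uncut columns are joined by K disjoint horizontal lines, so they
   lie on the same side. *)
Lemma cut_columns (g : Vtx -> bool) a0 b0 :
  (forall a b, used a b -> g a != g b -> (a, b) = (a0, b0) \/ (a, b) = (b0, a0)) ->
  exists beta, cols i <= K.-1 + count (on_column (fun v => g v == beta)) (iota 0 (cols i)).
Proof.
move=> /cut_edge cutg; have load := edge_load a0 b0.
pose us e := uses_edge (wp f e) a0 b0.
pose bad c := has (fun e => [&& us e, abscissa e.1 == c * D & abscissa e.2 == c * D]) (fE G).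
have badK : count bad (iota 0 (cols i)) <= K.-1.
  apply: leq_trans load; rewrite -!size_filter -(size_map (fun c => c * D)).
  rewrite -(size_map (fun e : Vtx * Vtx => abscissa e.1)); apply: uniq_leq_size.
    rewrite map_inj_uniq ?filter_uniq ?iota_uniq // => c c' /eqP.
    by rewrite eqn_pmul2r ?gapX_gt0 // => /eqP.
  move=> _ /mapP[c + ->]; rewrite mem_filter => /andP[/hasP[e eG /and3P[ue /eqP <- _]] _].
  by apply/mapP; exists e; rewrite ?mem_filter ?eG ?andbT.
have colc c : c < cols i -> ~~ bad c -> forall r, r < K ->
    g (wv f (emb i r (c * D))) = g (wv f (emb i 0 (c * D))).
  move=> cj /hasPn nb; apply: (@column_connected gapX i _ (g \o wv f)) => r rj /=.
  apply/eqP; apply: contraT => /(cutg (_, _) (mem_Vedge _ rj cj)) u.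
  by have := nb _ (mem_Vedge gapX rj cj); rewrite /us u /= /abscissa /= !eqxx.
have [c0 c0j nb0] : exists2 c, c < cols i & ~~ bad c.
  have /allPn[c] : ~~ all bad (iota 0 (cols i)).
    by rewrite all_count size_iota; apply/eqP; rewrite /cols -/K in badK *; lia.
  by rewrite mem_iota => /andP[_ ?] ?; exists c.
exists (g (wv f (emb i 0 (c0 * D)))).
rewrite -{1}(size_iota 0 (cols i)) -(count_predC bad) leq_add // -!size_filter.
apply: uniq_leq_size => [|c]; first by rewrite filter_uniq ?iota_uniq.
rewrite !mem_filter mem_iota add0n => /andP[nb /andP[_ cj]].
rewrite cj !andbT; apply/allP => r; rewrite mem_iota add0n => /andP[_ rK].
rewrite colc //; apply: contraT => neq.
(* If the two uncut columns disagree, every level [q] carries an edge of [G] over the cut edge;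
   otherwise row [q] would be constant and would join them. This makes [K] edges, told apart by
   their levels. *)
suff : K <= K.-1 by lia.
apply: leq_trans load; rewrite -{1}(size_iota 0 K) -size_filter.
rewrite -(size_map (fun e : Vtx * Vtx => level e.1)); apply: uniq_leq_size.
  exact: iota_uniq.
move=> q; rewrite mem_iota add0n => /andP[_ qK].
case: (boolP (has (fun e => us e && (level e.1 == q)) (fE G))) => [|/hasPn nu].
  move=> /hasP[e eG /andP[ue /eqP <-]]; apply/mapP; exists e => //.
  by rewrite mem_filter; apply/andP.
have rowc : forall x, x < cols i * D -> g (wv f (emb i q x)) = g (wv f (emb i q 0)).
  apply: (@row_connected gapX i _ (g \o wv f)) => x xj /=.
  apply/eqP; apply: contraT => /(cutg (_, _) (mem_Hedge qK xj)) u.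
  by have := nu _ (mem_Hedge qK xj); rewrite /us u level_emb //= eqxx.
have cD c' : c' < cols i -> c' * D < cols i * D by rewrite ltn_pmul2r ?gapX_gt0.
by case/eqP: neq; rewrite -(colc _ cj nb q qK) -(colc _ c0j nb0 q qK) !rowc ?cD.
Qed.

(** A discrete intermediate value argument. Take the least threshold below which all but [K - 1]
    columns lie entirely. One step earlier the majority side of the cut must be the upper one, so
    all but [K - 1] columns lie at or above the threshold. The columns in both families sit exactly
    on it. *)
Lemma sweep_columns (h : Vtx -> nat) :
  (forall z, exists a0 b0, forall a b, used a b ->
    (h a <= z) != (h b <= z) -> (a, b) = (a0, b0) \/ (a, b) = (b0, a0)) ->
  exists z, cols i <= K.-1 + K.-1 + count (on_column (fun v => h v == z)) (iota 0 (cols i)).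
Proof.
move=> cuth.
pose below z := count (on_column (fun v => h v <= z)) (iota 0 (cols i)).
have ex : exists z, cols i <= K.-1 + below z.
  exists (\max_(v <- fV G) h (wv f v)).
  apply: leq_trans (leq_addl _ _); rewrite -{1}(size_iota 0 (cols i)).
  rewrite leq_eqVlt eq_sym -all_count; apply/orP; left.
  apply/allP => c; rewrite mem_iota add0n => /andP[_ cj].
  apply/allP => r; rewrite mem_iota add0n => /andP[_ rK].
  apply: (@leq_bigmax_seq _ _ xpredT (fun v => h (wv f v))) => //.
  by apply: mem_stage_vertices; rewrite // ltn_pmul2r ?gapX_gt0.
case: (ex_minnP ex) => -[|z] bz min; [exists 0|exists z.+1].
  rewrite -addnA (leq_trans bz) // leq_add2l (leq_trans _ (leq_addl _ _)) //.
  by apply: sub_count => c; apply: sub_all => r; rewrite leqn0.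
have [a0 [b0 cutz]] := cuth z; have [beta cb] := cut_columns cutz.
case: beta cb => cb.
  (* A majority below [z] would contradict the minimality of [z.+1]. *)
  suff : z < z by rewrite ltnn.
  apply: min; apply: leq_trans cb _; rewrite leq_add2l.
  by apply: sub_count => c; apply: sub_all => r /eqP.
set A := on_column _ in cb; rewrite /below in bz; set B := on_column _ in bz.
have cAB := count_predUI A B (iota 0 (cols i)).
have cU : count (predU A B) (iota 0 (cols i)) <= cols i.
  by rewrite -{2}(size_iota 0 (cols i)) count_size.
have cI : count (predI A B) (iota 0 (cols i))
    <= count (on_column (fun v => h v == z.+1)) (iota 0 (cols i)).
  apply: sub_count => c /andP[/allP Ac /allP Bc]; apply/allP => r rK.
  by rewrite eqn_leq (Bc r rK) /= ltnNge; move: (Ac r rK) => /=; case: leq.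
by lia.
Qed.

Lemma area_gapX_sq_le_vol : area gapX i ^ 2 <= vol G f.
Proof.
set o := wv f (emb i 0 0); pose j := stage o.
have iV v : v \in fV G -> ladder_vertex gapY (wv f v) := wf.1 v.
have im_stage a : a \in im -> stage a = j.
  by apply: im_const => u v /used_edge /ladder_edge_stage.
have wv_stage v : v \in fV G -> stage (wv f v) = j by move=> /wv_in_im/im_stage.
(* If [j < i], stage [j] of [Y] is too small to receive stage [i] of [X] with at most [K - 1] points
   per vertex, because [area gapY j < gapX i]. *)
case: (ltnP j i) => [ji|ij].
  have : size (fV G) <= K.-1 * size (stage_vertices gapY j).
    apply: (size_le_fibers (h := wv f)) => [v vG|w]; last exact: cf.1.
    by rewrite -(wv_stage v vG); apply/ladder_vertexP/iV.
  rewrite /= !size_stage_vertices leqNgt => /negP[].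
  have Kcols : K.-1 <= K * cols i by rewrite /cols -/K; nia.
  apply: (@leq_ltn_trans (K * cols i * area gapY j)).
    by rewrite leq_mul2r Kcols orbT.
  rewrite {2}/area mulnA ltn_pmul2l ?area_gapY_lt // /cols -/K.
  by have := rows_gt1; rewrite -/K; nia.
have ri : 0 < rows i by apply: ltnW.
apply: leq_trans (area_gapX_sq_le ri ij) _; rewrite leqNgt; apply/negP => vlt.
have used_step a b : used a b ->
    (exists r x, [/\ r < rows j & (a, b) = (emb j r x, emb j r x.+1) \/
                                 (a, b) = (emb j r x.+1, emb j r x)]) \/
    (exists r c, [/\ r.+1 < rows j &
       (a, b) = (emb j r (c * gapY j), emb j r.+1 (c * gapY j)) \/
       (a, b) = (emb j r.+1 (c * gapY j), emb j r (c * gapY j))]).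
  move=> ab; have /im_stage := (used_in_im ab).1; have /im_stage := (used_in_im ab).2.
  case: (used_edge ab) => -[j' r x rj _|j' r c rj _].
  - by rewrite !stage_emb // => _ <-; left; exists r, x; split; [|left].
  - by rewrite !stage_emb ?(ltnW rj) // => _ <-; right; exists r, c; split; [|left].
  - by rewrite !stage_emb // => _ <-; left; exists r, x; split; [|right].
  - by rewrite !stage_emb ?(ltnW rj) // => _ <-; right; exists r, c; split; [|right].
(* A used pair changes the abscissa by at most 1. Were [z] missed, the truth value of [abscissa < z]
   would be constant on the connected image. *)
have attained a b z : a \in im -> b \in im -> abscissa a <= z <= abscissa b ->
    exists2 v, v \in im & abscissa v = z.
  move=> aI bI /andP[az zb].
  case: (boolP (has (fun v => abscissa v == z) im)) => [/hasP[v vI /eqP vz]|/hasPn no].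
    by exists v.
  have gE u v : used u v -> (abscissa u < z) = (abscissa v < z).
    move=> uv; have [/no uz /no vz] := used_in_im uv; move: uz vz.
    by have [[r [x [_ [][-> ->]]]]|[r [c [_ [][-> ->]]]]] := used_step _ _ uv;
      rewrite !abscissa_emb; lia.
  have ga := im_const gE aI; have gb := im_const gE bI.
  by move: (no _ aI) (no _ bI); rewrite -gb in ga; lia.
(* Otherwise [gapY j] distinct abscissas would be attained, more than the assumed volume. *)
have spread a b : a \in im -> b \in im -> abscissa b < abscissa a + gapY j.
  move=> aI bI; rewrite ltnNge; apply/negP => ab.
  suff : gapY j <= vol G f by rewrite leqNgt vlt.
  rewrite -{1}(size_iota (abscissa a) (gapY j)) /vol -(size_map abscissa).
  apply: uniq_leq_size => [|z]; first exact: iota_uniq.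
  rewrite mem_iota => /andP[az zb].
  have [|v vI <-] := attained a b z aI bI; first by rewrite az; lia.
  by rewrite map_f // mem_undup.
(* Rungs stand at multiples of [gapY j], and two multiples less than [gapY j] apart coincide. *)
have [s rung] : exists s, forall a b, used a b -> level a != level b ->
    abscissa a = s /\ abscissa b = s.
  have rung_eq a b : used a b -> level a != level b ->
      exists c, abscissa a = c * gapY j /\ abscissa b = c * gapY j.
    move=> /used_step[[r [x [rj eab]]]|[r [c [rj eab]]]].
      by case: eab => -[-> ->]; rewrite !level_emb ?eqxx.
    by case: eab => -[-> ->] _; exists c.
  pose pairs := flatten [seq zip (wp f e) (behead (wp f e)) | e <- fE G].
  have pairsP (a b : Vtx) : reflect (used a b) ((a, b) \in pairs).
    apply: (iffP flattenP) => [[_ /mapP[e eG ->] ab]|[e eG ab]]; first by exists e.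
    exists (zip (wp f e) (behead (wp f e))) => //.
    by apply/mapP; exists e.
  case: (boolP (has (fun p => level p.1 != level p.2) pairs)) => [/hasP|/hasPn no].
    move=> [[a0 b0] /pairsP u0 n0]; have [c0 [ca0 _]] := rung_eq _ _ u0 n0.
    exists (c0 * gapY j) => a b u n; have [c [ca cb]] := rung_eq _ _ u n.
    have [aI0 _] := used_in_im u0; have [aI _] := used_in_im u.
    have := spread _ _ aI aI0; have := spread _ _ aI0 aI.
    rewrite ca cb ca0 -!mulSnr !ltn_pmul2r ?gapY_gt0 // => ? ?.
    by have -> : c = c0 by lia.
  (* No rung is used here, so any value of [s] works. *)
  by exists 0 => a b /pairsP /no /negP nab /nab.
(* Vertical sweep: the level passes from [z] to [z.+1] only on the rung at abscissa [s]. *)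
have [|r0 col1] := sweep_columns (h := level).
  move=> z; exists (emb j z s), (emb j z.+1 s) => a b ab.
  have lab : (level a <= z) != (level b <= z) -> level a != level b.
    by apply: contraNneq => ->.
  move=> /[dup] /lab /(rung _ _ ab) [asx _]; move: asx; have := used_step _ _ ab.
  case=> [[r [x [rj eab]]]|[r [c [rj eab]]]].
    by case: eab => -[-> ->]; rewrite !level_emb ?eqxx.
  have rj' := ltnW rj; case: eab => -[-> ->]; rewrite abscissa_emb !level_emb // => -> neq.
    by left; have -> : r = z by lia.
  by right; have -> : r = z by lia.
(* Horizontal sweep along row [r0]: everything off that row is given the value [s], which is also
   the abscissa where rungs meet the row, so only horizontal edges of row [r0] change the value. *)
have [|z0 col2] := sweep_columns (h := fun v => if level v == r0 then abscissa v else s).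
  move=> z; exists (emb j r0 z), (emb j r0 z.+1) => a b ab.
  have := used_step _ _ ab.
  case=> [[r [x [rj eab]]]|rg].
    case: (r =P r0) rj eab => [->|/eqP/negPf rr0] rj eab; last first.
      by case: eab => -[-> ->]; rewrite /= !level_emb // rr0 eqxx.
    case: eab => -[-> ->]; rewrite /= !abscissa_emb !level_emb // eqxx => neq.
      by left; have -> : x = z by lia.
    by right; have -> : x = z by lia.
  have lab : level a != level b.
    by case: rg => r [c [rj [][-> ->]]]; rewrite !level_emb // 1?ltnW //; lia.
  by have [-> ->] := rung _ _ ab lab; rewrite !if_same eqxx.
(* Each family misses at most [2(K - 1)] of the [4K] columns, so they share a column. Its [K] points
   all go to [emb j r0 z0], against the load [K - 1]. *)
set A := on_column _ in col1; set B := on_column _ in col2.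
have cAB := count_predUI A B (iota 0 (cols i)).
have cU : count (predU A B) (iota 0 (cols i)) <= cols i.
  by rewrite -{2}(size_iota 0 (cols i)) count_size.
have : 0 < count (predI A B) (iota 0 (cols i)).
  by move: col1 col2 cU cAB; rewrite /cols -/K; have := rows_gt1; rewrite -/K; lia.
rewrite -has_count => /hasP[c]; rewrite mem_iota add0n => /andP[_ cj].
move=> /andP[/allP Ac /allP Bc].
pose w := emb j r0 z0; suff : K <= K.-1 by lia.
apply: leq_trans (cf.1 w); rewrite -{1}(size_iota 0 K) -size_filter.
rewrite -(size_map (fun r => emb i r (c * D))); apply: uniq_leq_size.
  rewrite map_inj_in_uniq ?iota_uniq // => r r'; rewrite !mem_iota !add0n /= => rK r'K.
  by move=> /emb_inj[].
move=> _ /mapP[r + ->] => rK; rewrite mem_filter.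
have vG : emb i r (c * D) \in fV G.
  apply: mem_stage_vertices; rewrite ?ltn_pmul2r ?gapX_gt0 //.
  by move: rK; rewrite mem_iota add0n.
rewrite vG andbT (ladder_vertex_emb (iV _ vG)) wv_stage //.
have /eqP lr := Ac _ rK; have := Bc _ rK; rewrite /= lr eqxx => /eqP ->.
by rewrite eqxx.
Qed.

End LowerBound.

(** * Upper bound *)

Lemma last_iota m n : last m (iota m.+1 n) = m + n.
Proof. by elim: n m => [|n IH] m /=; rewrite ?addn0 // IH addnS. Qed.

Lemma consecutive_map_iota (T : eqType) (g : nat -> T) m n a b :
  (a, b) \in zip [seq g z | z <- iota m n.+1] (behead [seq g z | z <- iota m n.+1]) ->
  exists z, [/\ m <= z < m + n, a = g z & b = g z.+1].
Proof.
elim: n m => [//|n IH] m; rewrite [iota m n.+2]/= !map_cons inE => /orP[/eqP[-> ->]|/IH].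
  by exists m; split => //; lia.
by case=> z [zb -> ->]; exists z; split => //; lia.
Qed.

(** * Stretching a line blockwise *)

Section Stretch.
Variables (D E : nat) (jump : nat -> nat).
Hypotheses (D_gt0 : 0 < D) (DE : D <= E).

(* Each block [tD, (t+1)D) is stretched to [tE, (t+1)E) by inserting E - D points just
   after the position [jump t]. *)
Definition stretch (x : nat) : nat :=
  x + (E - D) * (x %/ D + (jump (x %/ D) < x %% D)).

Lemma stretch_ltS x : stretch x < stretch x.+1.
Proof.
rewrite /stretch addSn ltnS leq_add2l leq_mul2l divnS // modnS; apply/orP; right.
case: (D %| x.+1) => /=; first by case: (_ < _); lia.
by rewrite leq_add2l; case: (ltnP _ (x %% D)) => // /ltnW; rewrite ltnS => ->.
Qed.

Lemma stretch_mul c : stretch (c * D) = c * E.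
Proof.
by rewrite /stretch mulnK // modnMl ltn0 /= addn0 [X in X + _]mulnC -mulnDl subnKC // mulnC.
Qed.

Lemma stretch_bound M x : x < M * D -> stretch x < M * E.
Proof.
rewrite -ltn_divLR // => xM; rewrite /stretch {1}(divn_eq x D).
have := ltn_pmod x D_gt0; move: (x %/ D) (x %% D) xM => t r tM rD.
apply: (@leq_trans (t.+1 * E)); last by rewrite leq_mul2r tM orbT.
move: (subnKC DE); set d := E - D => <-.
by case: (jump t < r); rewrite mulSn mulnDr ?addn0 ?mulnDr ?muln1 (mulnC d t); lia.
Qed.

(** Inside a block only the step leaving the jump position is lengthened. At the end of a block the
    indicator falls from 1 to 0 while the quotient grows by 1, and the two changes cancel. *)
Lemma stretch_succ x : jump (x %/ D) < D -> jump (x %/ D) != x %% D ->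
  stretch x.+1 = (stretch x).+1.
Proof.
move=> jD jx; rewrite /stretch addSn; congr (_ + _).+1; congr (_ * _).
rewrite divnS // modnS; case: (boolP (D %| x.+1)) => [dv|_] /=.
  have xD : x %% D = D.-1.
    apply/eqP; apply: contraLR dv => ne; rewrite /dvdn {1}(divn_eq x D) -addnS modnMDl.
    by have := ltn_pmod x D_gt0 => xD; rewrite modn_small //; lia.
  by move: jx jD; rewrite xD; lia.
by rewrite add0n; congr (_ + _); lia.
Qed.

End Stretch.

(** * The wiring that stretches all stages but one and flattens stage [i] *)

Section UpperBound.
Variables (i : nat) (Gam : Defs.fgraph).
Hypothesis rows_gt1 : 1 < rows i.
Hypothesis subG : finite_subgraph_of Gam (ladder gapX).
Hypothesis sizeG : size (fV Gam) <= area gapX i.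

Let Y := ladder gapY.

(** If the whole block is occupied, [find] returns its length [gapX j], and the insertion then falls
    on the last step of the block. *)
Definition empty_abscissa (j t : nat) : nat :=
  find (fun q => t * gapX j + q \notin map abscissa (fV Gam)) (iota 0 (gapX j)).

(** Stage [i] keeps its abscissas: its rungs collapse on row 0, so its columns need not land on
    columns of [Y]. *)
Definition new_abscissa (j x : nat) : nat :=
  if j == i then x else stretch (gapX j) (gapY j) (empty_abscissa j) x.

Definition new_level (j r : nat) : nat := if j == i then 0 else r.

Definition new_vertex (v : Vtx) : Vtx :=
  emb (stage v) (new_level (stage v) (level v)) (new_abscissa (stage v) (abscissa v)).

Definition step_path (a b : Vtx) : seq Vtx :=
  let j := stage a in
  if a.2 == b.2 then
    let u := new_abscissa j (abscissa a) in
    [seq emb j (new_level j (level a)) z | z <- iota u (new_abscissa j (abscissa b) - u).+1]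
  else if j == i then [:: new_vertex a] else [:: new_vertex a; new_vertex b].

(** Edges of [Gam] may be listed in either orientation; this boolean test tells which, so that
    [step_path] is only applied to genuine steps. *)
Definition low_first (e : Vtx * Vtx) : bool :=
  absz e.1.1 + absz e.1.2 < absz e.2.1 + absz e.2.2.

Definition stretch_wiring : wiring :=
  Wiring new_vertex
    (fun e => if low_first e then step_path e.1 e.2 else rev (step_path e.2 e.1)).

Let f := stretch_wiring.

Lemma rows_gt0 : 0 < rows i. Proof. exact: ltnW. Qed.

Lemma new_level_lt j r : r < rows j -> new_level j r < rows j.
Proof. by rewrite /new_level; case: eqP => [-> _|//]; apply: rows_gt0. Qed.

Lemma new_abscissa_ltS j x : new_abscissa j x < new_abscissa j x.+1.
Proof. by rewrite /new_abscissa; case: eqP => // _; apply: stretch_ltS; rewrite ?gapX_gt0 ?gapX_le_gapY. Qed.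

Lemma new_abscissa_mono j : {mono new_abscissa j : x y / x <= y}.
Proof.
apply: leq_mono => x y; apply: (homo_ltn (r := fun a b => a < b)) x y.
  by move=> b a c; apply: ltn_trans.
exact: new_abscissa_ltS.
Qed.

Lemma new_abscissa_inj j : injective (new_abscissa j).
Proof.
exact/incn_inj/new_abscissa_mono.
Qed.

Lemma new_abscissa_bound j x :
  x < cols j * gapX j -> new_abscissa j x < cols j * gapY j.
Proof.
rewrite /new_abscissa; case: eqP => [_ xj|_].
  by rewrite (leq_trans xj) // leq_mul2l gapX_le_gapY orbT.
by apply: stretch_bound; [apply: gapX_gt0|apply: gapX_le_gapY].
Qed.

(** A fully occupied block would need [gapX j] vertices, while [Gam] has at most
    [area gapX i < gapX j]. *)
Lemma empty_abscissa_lt j t : i < j -> empty_abscissa j t < gapX j.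
Proof.
move=> ij; rewrite /empty_abscissa -[X in _ < X](size_iota 0) -has_find.
apply: contraT => /hasPn nh.
suff : gapX j <= size (fV Gam).
  by move=> h; have := leq_ltn_trans sizeG (area_gapX_lt ij); rewrite ltnNge h.
rewrite -(size_map abscissa) -{1}(size_iota (t * gapX j) (gapX j)).
apply: uniq_leq_size => [|x]; first exact: iota_uniq.
rewrite mem_iota => /andP[tx xt].
have := nh (x - t * gapX j); rewrite mem_iota add0n negbK subnKC //; apply.
by rewrite /= ltn_subLR.
Qed.

Lemma empty_abscissaP j t : i < j ->
  t * gapX j + empty_abscissa j t \notin map abscissa (fV Gam).
Proof.
move=> ij; have lt := empty_abscissa_lt t ij.
have := nth_find 0 (a := fun q => t * gapX j + q \notin map abscissa (fV Gam))
  (s := iota 0 (gapX j)).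
rewrite has_find size_iota => /(_ lt).
by rewrite nth_iota //.
Qed.

(** In a later stage the jump position is no abscissa of [Gam], so a step starting at a vertex of
    [Gam] is never the lengthened one. *)
Lemma new_abscissa_succ v : v \in fV Gam -> i <= stage v ->
  new_abscissa (stage v) (abscissa v).+1 = (new_abscissa (stage v) (abscissa v)).+1.
Proof.
move=> vG; rewrite /new_abscissa; case: (stage v =P i) => [//|/eqP ne] le.
have ij : i < stage v by rewrite ltn_neqAle eq_sym ne.
apply: stretch_succ; [exact: gapX_gt0|exact: gapX_le_gapY|exact: empty_abscissa_lt|].
apply: contraL (empty_abscissaP (abscissa v %/ gapX (stage v)) ij) => /eqP ->.
by rewrite -divn_eq negbK map_f.
Qed.

Lemma new_abscissa_mul j c : j != i -> new_abscissa j (c * gapX j) = c * gapY j.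
Proof.
by move=> /negPf ji; rewrite /new_abscissa ji stretch_mul ?gapX_gt0 ?gapX_le_gapY.
Qed.

Lemma new_vertex_emb j r x : r < rows j ->
  new_vertex (emb j r x) = emb j (new_level j r) (new_abscissa j x).
Proof. by move=> rj; rewrite /new_vertex !embE. Qed.

Lemma stage_new_vertex v : ladder_vertex gapX v -> stage (new_vertex v) = stage v.
Proof. by move=> [j [r [x [rj xj ->]]]]; rewrite new_vertex_emb // !embE // new_level_lt. Qed.

Lemma new_vertexP v : ladder_vertex gapX v -> ladder_vertex gapY (new_vertex v).
Proof.
move=> [j [r [x [rj xj ->]]]]; rewrite new_vertex_emb //.
exists j, (new_level j r), (new_abscissa j x).
by rewrite new_level_lt ?new_abscissa_bound.
Qed.

(** Only the level can be lost, and only in stage [i]; fibres are therefore counted by levels. *)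
Lemma new_vertex_inj u v : ladder_vertex gapX u -> ladder_vertex gapX v ->
  new_vertex u = new_vertex v -> level u = level v -> u = v.
Proof.
move=> [j [r [x [rj xj ->]]]] [j' [r' [x' [rj' xj' ->]]]].
rewrite !new_vertex_emb // !level_emb // => e <-.
by have [<- _ /new_abscissa_inj ->] := emb_inj (new_level_lt rj) (new_level_lt rj') e.
Qed.

Lemma Hstep_path j r x : r < rows j ->
  step_path (emb j r x) (emb j r x.+1) =
  [seq emb j (new_level j r) z
     | z <- iota (new_abscissa j x) (new_abscissa j x.+1 - new_abscissa j x).+1].
Proof. by move=> rj; rewrite /step_path !embE // eqxx. Qed.

Lemma Vstep_path j r c : r.+1 < rows j ->
  step_path (emb j r (c * gapX j)) (emb j r.+1 (c * gapX j)) =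
  if j == i then [:: emb j 0 (c * gapX j)]
  else [:: emb j r (c * gapY j); emb j r.+1 (c * gapY j)].
Proof.
move=> rj; have rj' := ltnW rj; rewrite /step_path !new_vertex_emb // stage_emb //.
have /negPf -> : (emb j r (c * gapX j)).2 != (emb j r.+1 (c * gapX j)).2.
  by apply/eqP => -[]; lia.
rewrite /new_level; case: (j =P i) => [->|/eqP ji]; last by rewrite new_abscissa_mul.
by rewrite /new_abscissa eqxx.
Qed.

Lemma step_path_stage a b x : ladder_step gapX a b ->
  x \in step_path a b -> stage x = stage a.
Proof.
case=> [j r y rj yj|j r c rj cj].
  by rewrite Hstep_path // => /mapP[z _ ->]; rewrite !stage_emb ?new_level_lt.
have rj' := ltnW rj; rewrite Vstep_path // stage_emb //; case: (j == i).
  by rewrite inE => /eqP ->; rewrite stage_emb // (leq_trans _ rj).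
by rewrite !inE => /orP[] /eqP ->; rewrite stage_emb.
Qed.

Lemma step_path_in a b : ladder_step gapX a b ->
  is_path_in Y (step_path a b) (new_vertex a) (new_vertex b).
Proof.
case=> [j r x rj xj|j r c rj cj].
  rewrite Hstep_path // !new_vertex_emb //.
  have /ltnW le := new_abscissa_ltS j x; have bd := new_abscissa_bound xj.
  set m := new_abscissa j x in le *; set n := new_abscissa j x.+1 in le bd *.
  have rj' := new_level_lt rj; set r' := new_level j r in rj' *.
  exists [seq emb j r' z | z <- iota m.+1 (n - m)]; split => //.
  - by rewrite last_map last_iota subnKC.
  - by rewrite map_inj_uniq ?iota_uniq // => z z' /emb_inj[].
  - move=> _ /mapP[z + ->]; rewrite mem_iota => zb.
    by exists j, r', z; split => //; lia.
  - move=> u v /consecutive_map_iota[z [zb -> ->]].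
    by left; apply: Hstep => //; lia.
have rj' := ltnW rj; have r0 := leq_trans (ltn0Sn _) rj.
have st : ladder_step gapY (emb j r (c * gapY j)) (emb j r.+1 (c * gapY j)) by apply: Vstep.
have [v1 v2] := ladder_step_vertices gapY_gt0 st.
rewrite Vstep_path // !new_vertex_emb // /new_level; case: (j =P i) => [e|/eqP ji].
  subst j; rewrite /new_abscissa eqxx; exists [::]; split => // _ /[1!inE] /eqP ->.
  exists i, 0, (c * gapX i); split=> //.
  by rewrite (@leq_ltn_trans (c * gapY i)) ?leq_mul2l ?gapX_le_gapY ?orbT // ltn_pmul2r ?gapY_gt0.
rewrite new_abscissa_mul //; eexists; split; [reflexivity|by []| | |].
- by rewrite /= inE andbT; apply/eqP => /emb_inj[//|//|_ /eqP]; rewrite ltn_eqF.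
- by move=> x; rewrite !inE => /orP[] /eqP ->.
- by move=> x y; rewrite inE => /eqP[-> ->]; left.
Qed.

Lemma step_path_pairs a b u v : ladder_step gapX a b ->
  (u, v) \in zip (step_path a b) (behead (step_path a b)) ->
  (exists j r x z, [/\ r < rows j, a = emb j r x, b = emb j r x.+1,
     new_abscissa j x <= z < new_abscissa j x.+1 &
     (u, v) = (emb j (new_level j r) z, emb j (new_level j r) z.+1)]) \/
  (exists j r c, [/\ r.+1 < rows j, j != i,
     a = emb j r (c * gapX j), b = emb j r.+1 (c * gapX j) &
     (u, v) = (emb j r (c * gapY j), emb j r.+1 (c * gapY j))]).
Proof.
case=> [j r x rj xj|j r c rj cj].
  rewrite Hstep_path // => /consecutive_map_iota[z [zb -> ->]]; left.
  by exists j, r, x, z; split => //; have := new_abscissa_ltS j x; lia.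
rewrite Vstep_path //; case: ifP => [//|/negbT ji]; rewrite inE => /eqP uv; right.
by exists j, r, c.
Qed.

Lemma step_path_low a b u v : ladder_step gapX a b ->
  (u, v) \in zip (step_path a b) (behead (step_path a b)) ->
  absz u.1 + absz u.2 < absz v.1 + absz v.2.
Proof.
by move=> st /(step_path_pairs st) [[j [r [x [z [_ _ _ _ [-> ->]]]]]]|
  [j [r [c [_ _ _ _ [-> ->]]]]]]; rewrite /emb /=; lia.
Qed.

(** On a fixed row, the images of distinct horizontal steps are intervals with disjoint interiors,
    and distinct rungs go to distinct columns; so an edge of [Y] and a level determine the step. *)
Lemma step_path_inj a b a' b' u v :
  ladder_step gapX a b -> ladder_step gapX a' b' -> level a = level a' ->
  (u, v) \in zip (step_path a b) (behead (step_path a b)) ->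
  (u, v) \in zip (step_path a' b') (behead (step_path a' b')) ->
  (a, b) = (a', b').
Proof.
move=> st st' + /(step_path_pairs st) uv /(step_path_pairs st') uv'.
move: uv'; case: uv => [[j [r [x [z [rj -> -> xz ->]]]]]|[j [r [c [rj ji -> -> ->]]]]] uv';
case: uv' => [[j' [r' [x' [z' [rj' -> -> xz' e]]]]]|[j' [r' [c' [rj' ji' -> -> e]]]]].
- rewrite !level_emb // => rr; subst r'; have {}e := congr1 fst e.
  have [ej _ ez] := emb_inj (new_level_lt rj) (new_level_lt rj') e; subst j' z'.
  move: xz xz' => /andP[xz zx] /andP[x'z zx'].
  have ltE := leqW_mono (new_abscissa_mono j).
  have xx' : x < x'.+1 by rewrite -ltE (leq_ltn_trans xz).
  have x'x : x' < x.+1 by rewrite -ltE (leq_ltn_trans x'z).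
  by have -> : x = x' by lia.
- by move: e => []; lia.
- by move: e => []; lia.
- have rj0 := ltnW rj; have rj0' := ltnW rj'; rewrite !level_emb // => rr; subst r'; have {}e := congr1 fst e.
  have [ej _ /eqP] := emb_inj rj0 rj0' e; subst j'.
  by rewrite eqn_pmul2r ?gapY_gt0 // => /eqP ->.
Qed.

Lemma step_path_level a b u v : ladder_step gapX a b ->
  (u, v) \in zip (step_path a b) (behead (step_path a b)) ->
  level a < rows (stage u) /\ (stage u != i -> level a = level u).
Proof.
move=> st /(step_path_pairs st) [[j [r [x [z [rj -> _ _ [-> _]]]]]]|
  [j [r [c [rj _ -> _ [-> _]]]]]].
  have rj' := new_level_lt rj; rewrite !stage_emb // !level_emb //.
  by split=> // /negPf ji; rewrite /new_level ji.
by have rj' := ltnW rj; rewrite !stage_emb // !level_emb.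
Qed.

Definition orient (e : Vtx * Vtx) : Vtx * Vtx := if low_first e then e else (e.2, e.1).

Lemma orient_step e : e \in fE Gam -> ladder_step gapX (orient e).1 (orient e).2.
Proof.
have [_ _ _ h] := subG; move=> /h[_ _ + _].
case=> st; have lt := ladder_step_lt st; rewrite /orient /low_first; first by rewrite lt.
by rewrite ltnNge ltnW.
Qed.

Lemma orient_inj : {in fE Gam &, injective orient}.
Proof.
have [_ _ _ h] := subG; move=> [a b] [a' b'] eG e'G; rewrite /orient.
have [_ _ _ /negP n] := h _ eG.
by case: low_first; case: low_first => /= -[ea eb]; subst a' b'; rewrite // in n *.
Qed.

Lemma uses_orient e a b : e \in fE Gam -> uses_edge (wp f e) a b ->
  orient (a, b) \in zip (step_path (orient e).1 (orient e).2)
    (behead (step_path (orient e).1 (orient e).2)).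
Proof.
move=> eG; have st := orient_step eG.
have -> : uses_edge (wp f e) a b = uses_edge (step_path (orient e).1 (orient e).2) a b.
  by rewrite /= /orient; case: low_first; rewrite ?uses_edge_rev.
move=> /orP[] uv; have := step_path_low st uv; rewrite /orient /low_first => lt.
  by rewrite lt.
by rewrite ltnNge ltnW.
Qed.

Lemma vertex_in_ladder v : v \in fV Gam -> ladder_vertex gapX v.
Proof. by have [_ h _ _] := subG; apply: h. Qed.

Lemma edge_in_Gam e : e \in fE Gam -> e.1 \in fV Gam /\ e.2 \in fV Gam.
Proof. by have [_ _ _ h] := subG => /h[]. Qed.

Lemma stretch_is_wiring : is_wiring Gam Y f.
Proof.
split=> [v /vertex_in_ladder|e /orient_step]; first exact: new_vertexP.
rewrite /= /orient; case: low_first => /step_path_in //.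
exact/is_path_in_rev/ladder_sym.
Qed.

Lemma stretch_coarse : coarse (rows i) Gam Y f.
Proof.
split=> [w|a b _].
  (* The possible levels of a preimage of [w]: all [rows i] of them in stage [i], a single one
     elsewhere. *)
  pose t := if stage w == i then iota 0 (rows i) else [:: level w].
  apply: (@leq_trans (size t)); last first.
    by rewrite /t; case: ifP => _; rewrite ?size_iota ?rows_gt0.
  have uG : uniq (fV Gam) by have [] := subG.
  apply: (count_le_size_inj (h := level)) => // => [u v|v vG /eqP ew].
    rewrite !mem_filter => /andP[/eqP eu /vertex_in_ladder uX] /andP[/eqP ev /vertex_in_ladder vX].
    by apply: new_vertex_inj => //; rewrite -[RHS]/(wv f v) ev.
  have vX := vertex_in_ladder vG; rewrite /t -ew stage_new_vertex //.
  have := ladder_vertex_level vX; case: ifP => [/eqP -> lv|si lv]; first by rewrite mem_iota.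
  by rewrite inE /= /new_vertex /new_level si level_emb.
(* The same count for edges, with the stage read off from the lower end of the edge of [Y]. *)
pose w := (orient (a, b)).1.
pose t := if stage w == i then iota 0 (rows i) else [:: level w].
apply: (@leq_trans (size t)); last first.
  by rewrite /t; case: ifP => _; rewrite ?size_iota ?rows_gt0.
have uG : uniq (fE Gam) by have [] := subG.
apply: (count_le_size_inj (h := fun e => level (orient e).1)) => // [e e'|e eG ue].
  rewrite !mem_filter => /andP[ue eG] /andP[ue' e'G] lv; apply: orient_inj => //.
  have := uses_orient eG ue; have := uses_orient e'G ue'.
  rewrite [orient (a, b)]surjective_pairing => uv' uv.
  have := step_path_inj (orient_step eG) (orient_step e'G) lv uv uv'.
  by rewrite -!surjective_pairing.
have := uses_orient eG ue; rewrite [orient (a, b)]surjective_pairing -/w.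
move=> /(step_path_level (orient_step eG))[lt eq]; rewrite /t.
case: (stage w =P i) => [<-|/eqP/eq ->]; by rewrite ?mem_iota ?inE.
Qed.

Lemma stretch_vol : vol Gam f <= 2 * area gapX i.
Proof.
(* The earlier stages of [Y] are counted whole, for a total of at most [gapX i]; to them are added
   the images of the vertices. Each part has size at most [area gapX i]. *)
pose L := flatten [seq stage_vertices gapY j | j <- iota 0 i] ++ map new_vertex (fV Gam).
apply: (@leq_trans (size L)); last first.
  rewrite size_cat size_map mul2n -addnn leq_add //.
  apply: leq_trans (leq_trans (sum_area_gapY i) (gap_le_area gapX rows_gt0)).
  rewrite size_flatten sumnE !big_map leq_sum // => j _.
  by rewrite size_stage_vertices.
apply: uniq_leq_size; first exact: undup_uniq.
move=> v; rewrite mem_undup !mem_cat => /orP[->|/flattenP[_ /mapP[e eG ->] ve]].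
  by rewrite orbT.
have st := orient_step eG; have [e1 e2] := edge_in_Gam eG.
have {}ve : v \in step_path (orient e).1 (orient e).2.
  by move: ve; rewrite /= /orient; case: low_first; rewrite ?mem_rev.
have [o1 o2] : (orient e).1 \in fV Gam /\ (orient e).2 \in fV Gam.
  by rewrite /orient; case: low_first.
have sv := step_path_stage st ve.
have vY : ladder_vertex gapY v by have [q [_ _ _ + _]] := step_path_in st; apply.
case: (ltnP (stage v) i) => vi; apply/orP; [left|right].
  apply/flattenP; exists (stage_vertices gapY (stage v)); last exact: ladder_vertexP.
  by rewrite map_f // mem_iota.
(* From stage [i] on no edge of [Gam] is lengthened, so its path contains only the images of its two
   ends. *)
have : v = new_vertex (orient e).1 \/ v = new_vertex (orient e).2.
  move: ve vi; rewrite sv; move: o1; case: st => [j r x rj xj|j r c rj cj] o1.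
    have rj' := new_level_lt rj.
    rewrite Hstep_path // stage_emb // !new_vertex_emb // => /mapP[z + ->].
    rewrite mem_iota => zb ij; have := new_abscissa_succ o1.
    rewrite stage_emb // abscissa_emb => /(_ ij) e'; rewrite e' in zb *.
    case: (z =P new_abscissa j x) => [->|nz]; [by left | right].
    by congr emb; lia.
  have rj' := ltnW rj; rewrite Vstep_path // stage_emb // !new_vertex_emb //.
  rewrite /new_level; case: (j =P i) => [->|/eqP ji].
    by rewrite /new_abscissa eqxx inE => /eqP ->; left.
  by rewrite new_abscissa_mul // !inE => /orP[] /eqP ->; [left|right].
by case=> ->; rewrite map_f.
Qed.

End UpperBound.

(** * Choice of the infinite sets and conclusion *)

Lemma rows_pow k m : rows (2 ^ k * m.*2.+1) = k.
Proof.
rewrite /rows lognM ?expn_gt0 // pfactorK // logn_coprime ?addn0 //.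
by rewrite coprime2n /= odd_double.
Qed.

Theorem theorem1p1 :
  exists X Y : gsub, is_grid_subgraph X /\ is_grid_subgraph Y /\
    forall k : nat, (2 <= k)%N ->
      exists I : nat -> Prop, infinite_nat I /\
        forall n : nat, I n ->
          wirprof_ge (k - 1) X Y n
            ((n%:R / (k * (k + 1))%:R) ^+ 2 : rat)%R /\
          wirprof_le k X Y n (2 * n).
Proof.
exists (ladder gapX), (ladder gapY); split; first exact: ladder_is_grid_subgraph gapX_gt0.
split; first exact: ladder_is_grid_subgraph gapY_gt0.
(* The set [I] consists of the sizes of the stages of [X] with exactly [k] rows. *)
move=> k k2; exists (fun n => exists2 i, rows i = k & n = area gapX i); split.
  move=> m; exists (area gapX (2 ^ k * m.*2.+1)); split; last first.
    by exists (2 ^ k * m.*2.+1); rewrite ?rows_pow.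
  apply: leq_trans (gap_le_area gapX _); last by rewrite rows_pow ltnW.
  apply: leq_trans (ltnW (ltn_gapX _)).
  by have := expn_gt0 2 k; rewrite -addnn; nia.
move=> _ [i ik ->]; rewrite -ik in k2 *; split; last first.
  move=> Gam subG sizeG; exists (stretch_wiring i Gam).
  by split; [apply: stretch_is_wiring|apply: stretch_coarse|apply: stretch_vol].
exists (stage_graph gapX i); split; first exact: stage_graph_sub gapX_gt0.
  by rewrite size_stage_vertices.
move=> f wf; rewrite subn1 => cf; have := area_gapX_sq_le_vol k2 wf cf.
rewrite -(ler_nat rat); apply: le_trans; rewrite natrX.
(* The volume is at least [n ^ 2] with [n = area gapX i]; dividing [n] by [k * (k + 1) >= 1] only
   lowers the bound. *)
have d1 : (1 <= (rows i * (rows i + 1))%:R :> rat)%R by rewrite ler1n; nia.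
rewrite lerXn2r ?nnegrE ?divr_ge0 ?ler0n // ler_pdivrMr ?(lt_le_trans ltr01) //.
by rewrite ler_peMr ?ler0n.
Qed.
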